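(* Let $n$ be a positive constant, let $A(t)$ and $Q(t)$ be arbitrary smooth functions, and let $H(t)=\int Q(t)\,dt$. The equation $$u_t + A(t)\,u^n u_x + u^{2n}u_x + u_{xxx} + Q(t)\,u = 0$$ admits, for arbitrary constants $\tilde c_1,\tilde c_2$, the conservation law multiplier $$\Lambda=\tilde c_1 e^{2H}u+\tilde c_2 e^{H},$$ and from this multiplier one obtains the conservation law $D_tT+D_xX=0$ (holding on all solutions $u(t,x)$ of the equation) with conserved vector $$T=\tfrac12\tilde c_1 e^{2H}u^2+\tilde c_2 e^{H}u,$$ $$X=\tfrac12\tilde c_1 e^{2H}\left(2uu_{xx}-u_x^2\right)+\tilde c_2 e^{H}u_{xx}+\tilde c_1e^{2H}\frac{u^{2n+2}}{2n+2}+\tilde c_1e^{2H}A\frac{u^{n+2}}{n+2}+\tilde c_2e^{H}\frac{u^{2n+1}}{2n+1}+\tilde c_2e^{H}A\frac{u^{n+1}}{n+1}.$$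
   Context: $D_t$ and $D_x$ denote the total derivative operators with respect to $t$ and $x$. A multiplier is a function $\Lambda(t,x,u,u_x,u_{xx},\ldots)$ such that $$\left(u_t+A u^n u_x+u^{2n}u_x+u_{xxx}+Qu\right)\Lambda$$ is a divergence expression (of the form $D_t(\cdot)+D_x(\cdot)$) for all functions $u(t,x)$, not just solutions of the equation. $H=\int Q\,dt$ denotes a fixed antiderivative of $Q$. Powers of $u$ are understood where they are defined. *)

(* Defs.v *)
From Stdlib Require Import Reals Lra Lia ZArith ClassicalEpsilon.
From Coquelicot Require Import Coquelicot.
Open Scope R_scope.

(** * Real powers of a real number of arbitrary sign *)

(** [a = p/q] with [q] odd and [p] of the given parity ([true] = odd). The
    parity does not depend on the choice of such a fraction. *)
Definition odd_root_exponent (parity : bool) (a : R) : Prop :=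
  exists p q : Z,
    Z.odd p = parity /\ Z.odd q = true /\ a = IZR p / IZR q.

(** [u^a] is defined for [u > 0], for [u = 0] when [a >= 0], and for [u < 0]
    when [a] is an integer or, more generally, a fraction with odd
    denominator. *)
Definition rpow_defined (u a : R) : Prop :=
  0 < u \/ (u = 0 /\ 0 <= a) \/
  (u < 0 /\ exists parity : bool, odd_root_exponent parity a).

(** [Rpower] is [exp (a * ln u)], correct only for [u > 0]. The value of
    [rpow u a] is meaningful only under [rpow_defined u a]. *)
Definition rpow (u a : R) : R :=
  if Rlt_dec 0 u then Rpower u a
  else if Req_EM_T u 0 then (if Req_EM_T a 0 then 1 else 0)
  else if excluded_middle_informative (odd_root_exponent true a)
       then - Rpower (- u) a
       else Rpower (- u) a.

Lemma rpow_INR (u : R) (k : nat) : rpow u (INR k) = u ^ k.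
Proof.
unfold rpow.
destruct (Rlt_dec 0 u) as [Hu | Hu]; [now apply Rpower_pow|].
destruct (Req_EM_T u 0) as [-> | Hu0].
- destruct (Req_EM_T (INR k) 0) as [Hk | Hk].
  + apply (INR_eq k 0) in Hk; subst k; reflexivity.
  + destruct k as [|k]; [now elim Hk|]. simpl; ring.
- assert (Hm : 0 < - u) by lra.
  assert (Hsgn : u ^ k = (if Nat.odd k then -1 else 1) * (- u) ^ k).
  { clear. induction k as [|k IH]; [simpl; ring|].
    rewrite Nat.odd_succ, <- Nat.negb_odd; simpl; rewrite IH.
    destruct (Nat.odd k); simpl; ring. }
  assert (Hodd : odd_root_exponent true (INR k) <-> Nat.odd k = true).
  { assert (Hz : Z.odd (Z.of_nat k) = Nat.odd k).
    { clear. induction k as [|k IH]; [reflexivity|].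
      rewrite Nat2Z.inj_succ, Z.odd_succ, <- Z.negb_odd, IH.
      now rewrite Nat.odd_succ, <- Nat.negb_odd. }
    rewrite <- Hz. split.
    - intros (p & q & Hp & Hq & E).
      assert (Hq0 : IZR q <> 0).
      { intro K. apply eq_IZR in K. subst q. discriminate. }
      assert (E' : (Z.of_nat k * q = p)%Z).
      { apply eq_IZR. rewrite mult_IZR, <- INR_IZR_INZ, E. now field. }
      rewrite <- E', Z.odd_mul, Hq, Bool.andb_true_r in Hp. exact Hp.
    - intro K. exists (Z.of_nat k), 1%Z.
      repeat split; [exact K|]. rewrite <- INR_IZR_INZ. field. }
  rewrite Hsgn, Rpower_pow by exact Hm.
  destruct (excluded_middle_informative _) as [K | K].
  + apply Hodd in K. rewrite K. ring.
  + destruct (Nat.odd k); [|ring]. elim K. now apply Hodd.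
Qed.

(** * Differential functions and total derivatives *)

(** Jet coordinates: [v i j] stands for the derivative of [u] taken [i] times
    in [t] and [j] times in [x]; in particular [v 0%nat] is the sequence
    [u, u_x, u_xx, ...]. *)
Definition diff_function : Type := R -> R -> (nat -> nat -> R) -> R.

Definition finite_order (F : diff_function) : Prop :=
  exists k : nat, forall (t x : R) (v w : nat -> nat -> R),
    (forall i j : nat, (i + j <= k)%nat -> v i j = w i j) ->
    F t x v = F t x w.

(** [F[u]], as a function of [(t, x)]. *)
Definition along (F : diff_function) (u : R -> R -> R) (t x : R) : R :=
  F t x (fun i j => partial_derive i j u t x).

(** Total derivatives: [t] (resp. [x]) varies also inside [u] and its
    derivatives. *)
Definition Dt (F : diff_function) (u : R -> R -> R) (t x : R) : R :=
  Derive (fun s => along F u s x) t.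

Definition Dx (F : diff_function) (u : R -> R -> R) (t x : R) : R :=
  Derive (fun y => along F u t y) x.

(** [D_t T + D_x X = r] at [(t, x)] along [u]. The two existence conditions
    are needed because [Derive] is a total operator. *)
Definition divergence_eq (T X : diff_function) (u : R -> R -> R)
    (t x r : R) : Prop :=
  ex_derive (fun s => along T u s x) t /\
  ex_derive (fun y => along X u t y) x /\
  Dt T u t x + Dx X u t x = r.

(** * Multipliers and conservation laws *)

Definition smooth_on (J : R -> Prop) (f : R -> R) : Prop :=
  forall (k : nat) (t : R), J t -> ex_derive_n f k t.

(** Smooth functions [u(t,x)] on an open set of the plane, for which [u^n] is
    defined. The other powers in use have exponent [m * n + k] with [m], [k]
    natural numbers, and are then defined too since [0 < n]. *)
Definition admissible (n : R) (J : R -> Prop) (Omega : R * R -> Prop)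
    (u : R -> R -> R) : Prop :=
  open Omega /\
  (forall t x : R, Omega (t, x) -> J t) /\
  (forall (k : nat) (t x : R), Omega (t, x) -> ex_diff_n u k t x) /\
  (forall t x : R, Omega (t, x) -> rpow_defined (u t x) n).

(** [G] is the divergence [D_t T + D_x X], for all functions [u]. *)
Definition divergence_of (n : R) (J : R -> Prop) (G T X : diff_function)
    : Prop :=
  finite_order T /\ finite_order X /\
  forall (Omega : R * R -> Prop) (u : R -> R -> R),
    admissible n J Omega u ->
    forall t x : R, Omega (t, x) -> divergence_eq T X u t x (along G u t x).

Definition is_divergence (n : R) (J : R -> Prop) (G : diff_function) : Prop :=
  exists T X : diff_function, divergence_of n J G T X.

(** The left-hand side of the equation. *)
Definition gkdv (n : R) (A Q : R -> R) : diff_function := fun t x v =>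
  v 1%nat 0%nat + A t * rpow (v 0%nat 0%nat) n * v 0%nat 1%nat
  + rpow (v 0%nat 0%nat) (2 * n) * v 0%nat 1%nat + v 0%nat 3%nat
  + Q t * v 0%nat 0%nat.

(** A multiplier involves only [t], [x], [u] and the [x]-derivatives of [u]. *)
Definition x_jet_function (L : R -> R -> (nat -> R) -> R) : diff_function :=
  fun t x v => L t x (v 0%nat).

Definition times_multiplier (E : diff_function)
    (L : R -> R -> (nat -> R) -> R) : diff_function :=
  fun t x v => E t x v * x_jet_function L t x v.

Definition is_multiplier (n : R) (J : R -> Prop) (E : diff_function)
    (L : R -> R -> (nat -> R) -> R) : Prop :=
  finite_order (x_jet_function L) /\
  is_divergence n J (times_multiplier E L).

Definition conservation_law (n : R) (J : R -> Prop) (E T X : diff_function)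
    : Prop :=
  finite_order T /\ finite_order X /\
  forall (Omega : R * R -> Prop) (u : R -> R -> R),
    admissible n J Omega u ->
    (forall t x : R, Omega (t, x) -> along E u t x = 0) ->
    forall t x : R, Omega (t, x) -> divergence_eq T X u t x 0.

Definition multiplier (H : R -> R) (c1 c2 : R) : R -> R -> (nat -> R) -> R :=
  fun t x w => c1 * exp (2 * H t) * w 0%nat + c2 * exp (H t).

Definition density (H : R -> R) (c1 c2 : R) : diff_function := fun t x v =>
  let u := v 0%nat 0%nat in
  1 / 2 * c1 * exp (2 * H t) * u ^ 2 + c2 * exp (H t) * u.

Definition flux (n : R) (A H : R -> R) (c1 c2 : R) : diff_function :=
  fun t x v =>
  let u := v 0%nat 0%nat in
  let ux := v 0%nat 1%nat in
  let uxx := v 0%nat 2%nat in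
  1 / 2 * c1 * exp (2 * H t) * (2 * u * uxx - ux ^ 2)
  + c2 * exp (H t) * uxx
  + c1 * exp (2 * H t) * (rpow u (2 * n + 2) / (2 * n + 2))
  + c1 * exp (2 * H t) * A t * (rpow u (n + 2) / (n + 2))
  + c2 * exp (H t) * (rpow u (2 * n + 1) / (2 * n + 1))
  + c2 * exp (H t) * A t * (rpow u (n + 1) / (n + 1)).

(* Main.v *)
(** Once [rpow] obeys [u^(a+1) = u * u^a] and [(u^(a+1))' = (a+1) u^a] for
    [a > 0], the divergence of the given vector is the multiplier times the
    left-hand side by the product and chain rules. Both rules extend from
    [u > 0] to [u < 0] because adding 1 to a fraction with odd denominator flips
    the parity of its numerator, which is independent of the fraction chosen. *)

Require Import Defs.
From Stdlib Require Import Reals Lra Lia ZArith ClassicalEpsilon.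
From Coquelicot Require Import Coquelicot.
Open Scope R_scope.

(** * Parity of fractions with odd denominator *)

Lemma odd_denominator_neq_0 (q : Z) : Z.odd q = true -> IZR q <> 0.
Proof. intros Hq K. apply eq_IZR in K. subst q. discriminate. Qed.

(** Cross-multiplying two such fractions gives [p * q' = p' * q], and odd factors do not change
    parity. *)
Lemma odd_root_exponent_unique (b c : bool) (a : R) :
  odd_root_exponent b a -> odd_root_exponent c a -> b = c.
Proof.
intros (p & q & Hp & Hq & E) (p' & q' & Hp' & Hq' & E').
assert (Hq0 := odd_denominator_neq_0 _ Hq).
assert (Hq0' := odd_denominator_neq_0 _ Hq').
assert (K : (p * q' = p' * q)%Z).
{ apply eq_IZR. rewrite !mult_IZR.
  replace (IZR p) with (a * IZR q) by (rewrite E; now field).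
  replace (IZR p') with (a * IZR q') by (rewrite E'; now field). ring. }
apply (f_equal Z.odd) in K.
rewrite !Z.odd_mul, Hq, Hq', !Bool.andb_true_r in K. congruence.
Qed.

Lemma odd_root_exponent_succ (b : bool) (a : R) :
  odd_root_exponent b a -> odd_root_exponent (negb b) (a + 1).
Proof.
intros (p & q & Hp & Hq & ->). exists (p + q)%Z, q. repeat split.
- rewrite Z.odd_add, Hp, Hq. now destruct b.
- exact Hq.
- rewrite plus_IZR. field. now apply odd_denominator_neq_0.
Qed.

Lemma odd_root_exponent_double (b : bool) (a : R) :
  odd_root_exponent b a -> odd_root_exponent false (2 * a).
Proof.
intros (p & q & Hp & Hq & ->). exists (2 * p)%Z, q. repeat split.
- now rewrite Z.odd_mul.
- exact Hq.
- rewrite mult_IZR. field. now apply odd_denominator_neq_0.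
Qed.

Lemma rpow_defined_succ (u a : R) : rpow_defined u a -> rpow_defined u (a + 1).
Proof.
intros [Hu | [[Hu Ha] | [Hu [b Hb]]]]; [left | right; left | right; right].
- exact Hu.
- lra.
- split; [exact Hu | exists (negb b); now apply odd_root_exponent_succ].
Qed.

Lemma rpow_defined_double (u a : R) : rpow_defined u a -> rpow_defined u (2 * a).
Proof.
intros [Hu | [[Hu Ha] | [Hu [b Hb]]]]; [left | right; left | right; right].
- exact Hu.
- lra.
- split; [exact Hu | exists false; now apply odd_root_exponent_double with b].
Qed.

(** * Values of real powers by the sign of the base *)

Lemma rpow_pos (u a : R) : 0 < u -> rpow u a = Rpower u a.
Proof. intros Hu. unfold rpow. destruct (Rlt_dec 0 u); [reflexivity | lra]. Qed.

Lemma rpow_0_l (a : R) : a <> 0 -> rpow 0 a = 0.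
Proof.
intros Ha. unfold rpow. destruct (Rlt_dec 0 0); [lra|].
destruct (Req_EM_T 0 0); [|lra]. now destruct (Req_EM_T a 0).
Qed.

(** Uniqueness of the parity makes the test inside [rpow] return exactly [b]. *)
Lemma rpow_neg (b : bool) (u a : R) : u < 0 -> odd_root_exponent b a ->
  rpow u a = (if b then -1 else 1) * Rpower (- u) a.
Proof.
intros Hu Hb. unfold rpow. destruct (Rlt_dec 0 u); [lra|].
destruct (Req_EM_T u 0); [lra|].
destruct (excluded_middle_informative _) as [K | K].
- rewrite (odd_root_exponent_unique _ _ _ Hb K). ring.
- destruct b; [contradiction | ring].
Qed.

(** Away from 0 the branches of [rpow] differ only in sign. This bounds the difference quotient at 0
    from both sides. *)
Lemma Rabs_rpow (u a : R) : u <> 0 -> Rabs (rpow u a) = Rpower (Rabs u) a.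
Proof.
intros Hu. assert (Hpos : forall v, 0 < Rpower v a) by (intro; apply exp_pos).
unfold rpow. destruct (Rlt_dec 0 u).
- rewrite (Rabs_pos_eq u) by lra. apply Rabs_pos_eq, Rlt_le, Hpos.
- destruct (Req_EM_T u 0); [lra|]. rewrite (Rabs_left u) by lra.
  destruct (excluded_middle_informative _); rewrite ?Rabs_Ropp;
    apply Rabs_pos_eq, Rlt_le, Hpos.
Qed.

Lemma rpow_succ (u a : R) : 0 < a -> rpow_defined u a ->
  rpow u (a + 1) = u * rpow u a.
Proof.
intros Ha [Hu | [[-> _] | [Hu [b Hb]]]].
- rewrite !rpow_pos, Rpower_plus, Rpower_1 by lra. ring.
- rewrite !rpow_0_l by lra. ring.
- rewrite (rpow_neg _ _ _ Hu Hb).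
  rewrite (rpow_neg _ _ _ Hu (odd_root_exponent_succ _ _ Hb)).
  rewrite Rpower_plus, Rpower_1 by lra. destruct b; simpl; ring.
Qed.

(** * The power rule for bases of any sign *)

Lemma is_derive_Rpower (u a : R) : 0 < u ->
  is_derive (fun v => Rpower v (a + 1)) u ((a + 1) * Rpower u a).
Proof.
intros Hu. apply is_derive_Reals.
replace (Rpower u a) with (Rpower u (a + 1 - 1)) by (f_equal; ring).
now apply derivable_pt_lim_power.
Qed.

(* On the negative side of 0 the power may be undefined, but only its absolute
   value matters for the difference quotient at 0. *)
Lemma is_derive_rpow_0 (a : R) : 0 < a ->
  is_derive (fun v => rpow v (a + 1)) 0 0.
Proof.
intros Ha. apply is_derive_Reals. intros eps Heps.
(* The difference quotient at 0 has absolute value [|h|^a], which is below [eps] once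
   [|h| < eps^(1/a)]. *)
exists (mkposreal (Rpower eps (/ a)) (exp_pos _)). intros h Hh Hlt.
simpl in Hlt. assert (Hpos := Rabs_pos_lt _ Hh).
rewrite Rplus_0_l, (rpow_0_l (a + 1)), !Rminus_0_r by lra.
unfold Rdiv. rewrite Rabs_mult, Rabs_inv, (Rabs_rpow _ _ Hh).
rewrite Rpower_plus, Rpower_1 by lra.
replace (Rpower (Rabs h) a * Rabs h * / Rabs h) with (Rpower (Rabs h) a)
  by (field; lra).
replace eps with (Rpower (Rpower eps (/ a)) a).
- now apply Rlt_Rpower_l.
- rewrite Rpower_mult, Rinv_l, Rpower_1; lra.
Qed.

Lemma is_derive_rpow (u a : R) : 0 < a -> rpow_defined u a ->
  is_derive (fun v => rpow v (a + 1)) u ((a + 1) * rpow u a).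
Proof.
intros Ha [Hu | [[-> _] | [Hu [b Hb]]]].
- rewrite rpow_pos by exact Hu.
  apply is_derive_ext_loc with (fun v => Rpower v (a + 1)).
  + apply (filter_imp (fun v => 0 < v)); [|now apply (open_gt 0)].
    intros v Hv. symmetry. now apply rpow_pos.
  + now apply is_derive_Rpower.
- rewrite rpow_0_l, Rmult_0_r by lra. now apply is_derive_rpow_0.
- rewrite (rpow_neg _ _ _ Hu Hb).
  (* The base stays negative near [u], so the sign there is constant. It is opposite to that of
     [u^a], which offsets the factor -1 from differentiating [- v]. *)
  apply is_derive_ext_loc with
    (fun v => (if negb b then -1 else 1) * Rpower (- v) (a + 1)).
  + apply (filter_imp (fun v => v < 0)); [|now apply (open_lt 0)].
    intros v Hv. symmetry.
    now apply rpow_neg, odd_root_exponent_succ.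
  + assert (Hu' : 0 < - u) by lra.
    assert (Hopp : is_derive (fun v => - v) u (-1))
      by (auto_derive; [exact I | ring]).
    evar_last.
    * apply is_derive_scal.
      apply (is_derive_comp (fun v => Rpower v (a + 1)) (fun v => - v)).
      -- now apply is_derive_Rpower.
      -- exact Hopp.
    * unfold scal; simpl. unfold mult; simpl.
      destruct b; simpl; ring.
Qed.

Lemma is_derive_rpow_comp (f : R -> R) (x df a : R) : 0 < a ->
  rpow_defined (f x) a -> is_derive f x df ->
  is_derive (fun y => rpow (f y) (a + 1) / (a + 1)) x (df * rpow (f x) a).
Proof.
intros Ha Hd Hf.
assert (Hc := is_derive_comp (fun v => rpow v (a + 1)) f x _ _
  (is_derive_rpow _ _ Ha Hd) Hf).
apply is_derive_ext with
  (fun y => / (a + 1) * (fun y => rpow (f y) (a + 1)) y).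
- intros y. apply Rmult_comm.
- evar_last; [exact (is_derive_scal _ _ (/ (a + 1)) _ Hc)|].
  unfold scal; simpl. unfold mult; simpl. field. lra.
Qed.

(** * Partial derivatives of a smooth function *)

Lemma ex_diff_n_ex_derive_t (u : R -> R -> R) (k : nat) (t x : R) :
  ex_diff_n u (S k) t x -> ex_derive (fun s => u s x) t.
Proof. simpl. tauto. Qed.

(** The last component of [ex_diff_n] is the same property, one order lower, for [u_x]; hence the
    induction with [u] generalized. *)
Lemma ex_diff_n_ex_derive_x (k : nat) : forall (u : R -> R -> R) (t x : R),
  ex_diff_n u (S k) t x -> ex_derive (Derive_n (u t) k) x.
Proof.
induction k as [|k IH]; intros u t x Hu.
- simpl in *. tauto.
- destruct Hu as (_ & _ & _ & _ & Hu). apply IH in Hu.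
  refine (ex_derive_ext _ _ _ _ Hu).
  intros y. replace (S k) with (k + 1)%nat by lia.
  exact (Derive_n_comp (u t) k 1 y).
Qed.

(** * Order and derivatives of the density and flux *)

Lemma finite_order_multiplier (H : R -> R) (c1 c2 : R) :
  finite_order (x_jet_function (multiplier H c1 c2)).
Proof.
exists 0%nat. intros t x v w E. unfold x_jet_function, multiplier.
now rewrite E.
Qed.

Lemma finite_order_density (H : R -> R) (c1 c2 : R) :
  finite_order (density H c1 c2).
Proof.
exists 0%nat. intros t x v w E. unfold density. now rewrite E.
Qed.

Lemma finite_order_flux (n : R) (A H : R -> R) (c1 c2 : R) :
  finite_order (flux n A H c1 c2).
Proof.
exists 2%nat. intros t x v w E. unfold flux. rewrite !E by lia. reflexivity.
Qed.

(** Differentiating the exponentials produces the term [q * u], which becomes [Q u] when [H' = Q];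
    the multiplier then factors out. *)
Lemma is_derive_density (H : R -> R) (c1 c2 : R) (u : R -> R -> R)
    (t x q ut : R) :
  is_derive H t q -> is_derive (fun s => u s x) t ut ->
  is_derive (fun s => along (density H c1 c2) u s x) t
    ((q * u t x + ut) * (c1 * exp (2 * H t) * u t x + c2 * exp (H t))).
Proof.
intros HH Hu.
(* An abstract one-variable [f] replaces the jet coordinate, a form that [auto_derive] can treat. *)
assert (G : forall f : R -> R, is_derive f t ut ->
  is_derive (fun s => 1 / 2 * c1 * exp (2 * H s) * f s ^ 2
                      + c2 * exp (H s) * f s) t
    ((q * f t + ut) * (c1 * exp (2 * H t) * f t + c2 * exp (H t)))).
{ intros f Hf. auto_derive.
  - repeat split; eexists; eassumption.
  - rewrite (is_derive_unique (fun y : R => H y) _ _ HH).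
    rewrite (is_derive_unique (fun y : R => f y) _ _ Hf). field. }
exact (G (fun s => u s x) Hu).
Qed.

(** At fixed [t] the exponentials and [A] are constants [E2], [E1], [a]. The functions [p1] to [p4]
    stand for the terms [u^m / m] with [m] equal to [n+1], [n+2], [2n+1], [2n+2]. *)
Lemma is_derive_flux_form (E2 E1 a c1 c2 : R)
    (f f1 f2 p1 p2 p3 p4 : R -> R) (x d0 d1 d2 e1 e2 e3 e4 : R) :
  is_derive f x d0 -> is_derive f1 x d1 -> is_derive f2 x d2 ->
  is_derive p1 x e1 -> is_derive p2 x e2 ->
  is_derive p3 x e3 -> is_derive p4 x e4 ->
  is_derive (fun y =>
    1 / 2 * c1 * E2 * (2 * f y * f2 y - f1 y ^ 2) + c2 * E1 * f2 y
    + c1 * E2 * p4 y + c1 * E2 * a * p2 y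
    + c2 * E1 * p3 y + c2 * E1 * a * p1 y) x
    (c1 * E2 * (d0 * f2 x + f x * d2 - f1 x * d1) + c2 * E1 * d2
     + c1 * E2 * e4 + c1 * E2 * a * e2 + c2 * E1 * e3 + c2 * E1 * a * e1).
Proof.
intros H0 H1 H2 P1 P2 P3 P4. auto_derive.
- repeat split; eexists; eassumption.
- rewrite (is_derive_unique (fun y : R => p1 y) _ _ P1).
  rewrite (is_derive_unique (fun y : R => p2 y) _ _ P2).
  rewrite (is_derive_unique (fun y : R => p3 y) _ _ P3).
  rewrite (is_derive_unique (fun y : R => p4 y) _ _ P4).
  rewrite (is_derive_unique (fun y : R => f y) _ _ H0).
  rewrite (is_derive_unique (fun y : R => f1 y) _ _ H1).
  rewrite (is_derive_unique (fun y : R => f2 y) _ _ H2). field.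
Qed.

Lemma is_derive_flux (n : R) (A H : R -> R) (c1 c2 : R) (u : R -> R -> R)
    (t x : R) :
  0 < n -> rpow_defined (u t x) n ->
  (forall k, (k <= 2)%nat -> ex_derive (Derive_n (u t) k) x) ->
  is_derive (fun y => along (flux n A H c1 c2) u t y) x
    ((A t * rpow (u t x) n * Derive_n (u t) 1 x
      + rpow (u t x) (2 * n) * Derive_n (u t) 1 x + Derive_n (u t) 3 x)
     * (c1 * exp (2 * H t) * u t x + c2 * exp (H t))).
Proof.
intros Hn Hd Hu.
assert (H0 : is_derive (u t) x (Derive_n (u t) 1 x))
  by apply (Derive_correct _ _ (Hu 0%nat ltac:(lia))).
assert (H1 : is_derive (Derive_n (u t) 1) x (Derive_n (u t) 2 x))
  by apply (Derive_correct _ _ (Hu 1%nat ltac:(lia))).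
assert (H2 : is_derive (Derive_n (u t) 2) x (Derive_n (u t) 3 x))
  by apply (Derive_correct _ _ (Hu 2%nat ltac:(lia))).
assert (Hd2 := rpow_defined_double _ _ Hd).
assert (P1 := is_derive_rpow_comp _ _ _ _ Hn Hd H0).
assert (P2 := is_derive_rpow_comp _ _ _ (n + 1) ltac:(lra)
  (rpow_defined_succ _ _ Hd) H0).
assert (P3 := is_derive_rpow_comp _ _ _ (2 * n) ltac:(lra) Hd2 H0).
assert (P4 := is_derive_rpow_comp _ _ _ (2 * n + 1) ltac:(lra)
  (rpow_defined_succ _ _ Hd2) H0).
(* Splitting off a factor [u] leaves only [u^n] and [u^(2n)], so that the multiplier becomes a
   common factor. *)
rewrite rpow_succ in P2 by assumption.
rewrite (rpow_succ _ (2 * n)) in P4 by (lra || assumption).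
replace (n + 1 + 1) with (n + 2) in P2 by ring.
replace (2 * n + 1 + 1) with (2 * n + 2) in P4 by ring.
evar_last.
- exact (is_derive_flux_form (exp (2 * H t)) (exp (H t)) (A t) c1 c2
    _ _ _ _ _ _ _ _ _ _ _ _ _ _ _ H0 H1 H2 P1 P2 P3 P4).
(* The products [u_x u_xx] cancel, leaving [u u_xxx] from the quadratic part. *)
- cbv beta. ring.
Qed.

(** * The divergence identity and the conservation law *)

Lemma divergence_of_gkdv (n : R) (J : R -> Prop) (A Q H : R -> R) (c1 c2 : R) :
  0 < n -> (forall t : R, J t -> is_derive H t (Q t)) ->
  divergence_of n J (times_multiplier (gkdv n A Q) (multiplier H c1 c2))
    (density H c1 c2) (flux n A H c1 c2).
Proof.
intros Hn HH. split; [apply finite_order_density|].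
split; [apply finite_order_flux|].
intros Omega u (_ & HJ & Hsm & Hd) t x Hin.
assert (HT := is_derive_density H c1 c2 u t x _ _ (HH t (HJ _ _ Hin))
  (Derive_correct _ _ (ex_diff_n_ex_derive_t _ 0 _ _ (Hsm 1%nat _ _ Hin)))).
assert (HX := is_derive_flux n A H c1 c2 u t x Hn (Hd _ _ Hin)
  (fun k _ => ex_diff_n_ex_derive_x k _ _ _ (Hsm (S k) _ _ Hin))).
split; [eexists; exact HT|]. split; [eexists; exact HX|].
(* The density supplies [u_t + Q u] and the flux the other terms of the equation, each times the
   multiplier. *)
refine (eq_trans (f_equal2 Rplus (is_derive_unique _ _ _ HT)
  (is_derive_unique _ _ _ HX)) _).
unfold along, times_multiplier, gkdv, x_jet_function, multiplier,
  partial_derive.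
simpl. ring.
Qed.

(** On solutions [E] vanishes, and with it the product that the divergence equals. *)
Lemma conservation_law_of_divergence (n : R) (J : R -> Prop)
    (E T X : diff_function) (L : R -> R -> (nat -> R) -> R) :
  divergence_of n J (times_multiplier E L) T X -> conservation_law n J E T X.
Proof.
intros (HT & HX & HD). split; [exact HT|]. split; [exact HX|].
intros Omega u Hu HE t x Hin.
destruct (HD Omega u Hu t x Hin) as (H1 & H2 & H3).
split; [exact H1|]. split; [exact H2|].
rewrite H3. unfold along, times_multiplier.
assert (H0 := HE t x Hin). unfold along in H0. rewrite H0. ring.
Qed.

Theorem mainTheorem4 (n : R) (hn : 0 < n)
    (J : R -> Prop) (hJ : open J)
    (A Q H : R -> R) (hA : smooth_on J A) (hQ : smooth_on J Q)
    (hH : forall t : R, J t -> is_derive H t (Q t))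
    (c1 c2 : R) :
  is_multiplier n J (gkdv n A Q) (multiplier H c1 c2) /\
  divergence_of n J (times_multiplier (gkdv n A Q) (multiplier H c1 c2))
    (density H c1 c2) (flux n A H c1 c2) /\
  conservation_law n J (gkdv n A Q) (density H c1 c2) (flux n A H c1 c2).
Proof.
assert (HD := divergence_of_gkdv n J A Q H c1 c2 hn hH).
split; [|split].
- split; [apply finite_order_multiplier|]. eexists. eexists. exact HD.
- exact HD.
- exact (conservation_law_of_divergence _ _ _ _ _ _ HD).
Qed.
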